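(* Let $G$ be a finite simple forest on vertex set $\{x_1,\dots,x_n\}$ with $\operatorname{mat}(G)\geq 2$, let $\Bbbk$ be a field and $S=\Bbbk[x_1,\dots,x_n]$. Then \[\operatorname{reg}(I(G)^{[2]})=\operatorname{aim}(G,2)+2.\]
   Context: $I(G)\subseteq S$ is the edge ideal, generated by $x_ix_j$ for edges $\{x_i,x_j\}$ of $G$. $\operatorname{mat}(G)$ is the matching number. For $k\ge1$, $I(G)^{[k]}$ is the ideal generated by the products $e_1\cdots e_k$ over all matchings $\{e_1,\dots,e_k\}$ of size $k$ (edge $\{x_i,x_j\}$ identified with $x_ix_j$). $\operatorname{reg}$ is Castelnuovo–Mumford regularity. Two edges form a gap if they are disjoint and no edge of $G$ joins a vertex of one to a vertex of the other. A sequence $(a_1,\dots,a_n)$ of integers is $k$-admissable if $a_i\ge1$ for all $i$ and $\sum a_i\le n+k-1$. For $1\le k\le\operatorname{mat}(G)$, a matching $M$ is $k$-admissable if there are nonempty pairwise disjoint $M_1,\dots,M_r\subseteq M$ with union $M$ such that edges from different $M_i$'s always form a gap in $G$, $(|M_1|,\dots,|M_r|)$ is $k$-admissable, and the induced subgraph of $G$ on $\bigcup_{e\in M_i}e$ is a forest for each $i$. $\operatorname{aim}(G,k)$ is the maximum size of a $k$-admissable matching ($0$ if none). *)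

(* Defs.v *)
From HB Require Import structures.
From mathcomp Require Import all_boot all_order all_algebra.
Set Implicit Arguments.
Unset Strict Implicit.
Unset Printing Implicit Defensive.
Import GRing.Theory.

(* A finite simple graph is a symmetric irreflexive relation G : rel 'I_n
   (symmetry / irreflexivity are hypotheses of the theorem).            *)

Definition edges n (G : rel 'I_n) : {set {set 'I_n}} :=
  [set [set u; v] | u in [set: 'I_n], v in [set: 'I_n] & G u v].

(* a cycle of G all of whose vertices lie in V: a duplicate-free sequence
   v_0..v_{l-1}, l >= 3, with consecutive vertices and v_{l-1},v_0 adjacent.
   A duplicate-free sequence has length <= n, so quantifying over tuples of
   length l <= n is exhaustive. *)
Definition has_cycle_in n (G : rel 'I_n) (V : {set 'I_n}) : bool :=
  [exists l : 'I_n.+1, [exists c : l.-tuple 'I_n,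
     [&& uniq c, 2 < size c, all (fun v => v \in V) c & cycle G c]]].

Definition forest_on n (G : rel 'I_n) (V : {set 'I_n}) : bool :=
  ~~ has_cycle_in G V.

Definition forest n (G : rel 'I_n) : bool := forest_on G setT.

Definition is_matching n (G : rel 'I_n) (M : {set {set 'I_n}}) : bool :=
  (M \subset edges G) && trivIset M.

Definition mat n (G : rel 'I_n) : nat :=
  \max_(M : {set {set 'I_n}} | is_matching G M) #|M|.

Definition gap n (G : rel 'I_n) (e f : {set 'I_n}) : bool :=
  [disjoint e & f] && [forall u in e, [forall v in f, ~~ G u v]].

Definition admissable_seq (k : nat) (a : seq nat) : bool :=
  all (fun x => 0 < x) a && (sumn a <= size a + k - 1).

Definition adm_matching n (G : rel 'I_n) (k : nat) (M : {set {set 'I_n}}) : bool :=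
  is_matching G M &&
  [exists P : {set {set {set 'I_n}}},
    [&& partition P M, set0 \notin P,
        [forall B1 in P, [forall B2 in P, (B1 != B2) ==>
           [forall e in B1, [forall f in B2, gap G e f]]]],
        admissable_seq k [seq #|B| | B : {set {set 'I_n}} <- enum P] &
        [forall B in P, forest_on G (cover B)]]].

Definition aim n (G : rel 'I_n) (k : nat) : nat :=
  \max_(M : {set {set 'I_n}} | adm_matching G k M) #|M|.

(* A monomial x^m of S = k[x_1..x_n] is an exponent vector m : 'I_n -> nat.
   A monomial ideal is represented by its membership predicate on monomials.
   I(G)^[k] is generated by the products e_1...e_k over matchings of size k,
   i.e. by the squarefree monomials with exponent vector the indicator of
   cover M; a monomial lies in I(G)^[k] iff some such generator divides it. *)
Definition matching_power n (G : rel 'I_n) (k : nat) (m : 'I_n -> nat) : bool :=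
  [exists M : {set {set 'I_n}},
    [&& is_matching G M, #|M| == k &
        [forall v, ((v \in cover M) : nat) <= m v]]].

(* beta_{i,j}(I) = dim_F Tor_i^S(F, I)_j = dim_F H_i(x_1..x_n ; I)_j.
   The degree-j part of K_i(x; I) = /\^i S^n (-i) (x) I has basis the pairs
   (e_A, x^m) with #|A| = i, deg m = j - i and x^m in I.  We index such pairs
   by ({set 'I_n} * {ffun 'I_n -> 'I_j.+1}) (exponents of a monomial of degree
   <= j are <= j); pairs violating the conditions are simply not basis
   elements ("valid" below).  The differential is
   d(e_A (x) x^m) = sum_{t in A} (-1)^{#{u in A | u < t}} e_{A\t} (x) x_t x^m,
   written as a matrix acting on row vectors. *)
Definition kvalid n (I : ('I_n -> nat) -> bool) (i j : nat)
  (b : ({set 'I_n} * {ffun 'I_n -> 'I_j.+1})%type) : bool :=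
  [&& #|b.1| == i, i <= j, \sum_(v < n) (b.2 v : nat) == j - i
    & I (fun v => b.2 v : nat)].
Arguments kvalid {n} I i j b.

Definition kentry (F : fieldType) n (I : ('I_n -> nat) -> bool) (i j : nat)
  (b b' : ({set 'I_n} * {ffun 'I_n -> 'I_j.+1})%type) : F :=
  if [&& 0 < i, kvalid I i j b & kvalid I i.-1 j b'] then
    (\sum_(t in b.1 | (b'.1 == b.1 :\ t) &&
                      [forall v, (b'.2 v : nat) == ((b.2 v : nat) + (v == t))%N])
        (-1) ^+ #|[set u in b.1 | (u < t)%N]|)%R
  else 0%R.
Arguments kentry F {n} I i j b b'.

Definition koszul_mx (F : fieldType) n (I : ('I_n -> nat) -> bool) (i j : nat)
  : 'M[F]_(#|{: {set 'I_n} * {ffun 'I_n -> 'I_j.+1}}|) :=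
  \matrix_(a, b) kentry F I i j (enum_val a) (enum_val b).

(* beta_{i,j} = dim ker d_i - dim im d_{i+1}  (degree j part) *)
Definition betti (F : fieldType) n (I : ('I_n -> nat) -> bool) (i j : nat) : nat :=
  #|[set b : ({set 'I_n} * {ffun 'I_n -> 'I_j.+1})%type | kvalid I i j b]|
  - \rank (koszul_mx F I i j) - \rank (koszul_mx F I i.+1 j).

Definition reg_is (F : fieldType) n (I : ('I_n -> nat) -> bool) (r : nat) : Prop :=
  (exists i j, betti F I i j <> 0 /\ j = i + r) /\
  (forall i j, betti F I i j <> 0 -> j <= i + r).

(* Main.v *)
Require Import Defs.
From mathcomp Require Import all_boot all_order all_algebra.
From mathcomp Require Import ring.
Set Implicit Arguments.
Unset Strict Implicit.
Unset Printing Implicit Defensive.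
Import GRing.Theory.

(* In multidegree [W] the Koszul homology of a squarefree monomial ideal is the
   homology of the complex of those [A] for which [W :\: A] spans a monomial of
   the ideal. Deleting a vertex [v] of [W] gives a long exact sequence whose
   other terms come from the ideal restricted to [W :\ v] (the link) and from
   its colon by [v] (the deletion).

   Upper bound: in a forest with an edge, the end of a longest path gives a leaf
   [x], its neighbour [y], and a vertex [z] such that every neighbour of [y]
   other than [z] is a leaf. Split off [y], then its neighbours, [z] last. The
   ideals met are the same squarefree power on fewer vertices, or, after taking
   the colon by both ends of a pendant edge, the next lower power. In the latter
   case the pendant edge can be added to an admissible matching, because only the
   edge through [z] may fail to form a gap with it.

   Lower bound: the homology in multidegree the vertex set of a maximum
   admissible matching does not vanish. Split off the two ends of an edge that
   forms gaps with all the others: a nonzero class for the remaining edges lifts,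
   because the edge ideal itself has no homology in the relevant degree. *)

(** * Koszul strands as chain complexes *)

Section Chains.
Variables (F : fieldType) (n : nat).
Implicit Types (A B U W : {set 'I_n}) (t v : 'I_n) (P : pred {set 'I_n}).
Local Notation chain := {ffun {set 'I_n} -> F}.
Implicit Types b c : chain.
Local Open Scope ring_scope.

Definition incidence A t : F := (-1) ^+ #|[set u in A | (u < t)%N]|.

(** Interior product by the basis vector [t]; [join v] is the exterior product with [v]. Writing
    [bd] as a sum of contractions reduces its identities to their anticommutation. *)
Definition contract t c : chain :=
  [ffun A : {set 'I_n} => if t \in A then 0 else incidence A t * c (t |: A)].

Definition join v c : chain :=
  [ffun A : {set 'I_n} => if v \in A then incidence (A :\ v) v * c (A :\ v) else 0].

Definition bd c : chain := \sum_t contract t c.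

Lemma incidence_sq A t : incidence A t * incidence A t = 1.
Proof. by rewrite -expr2 sqrr_sign. Qed.

Lemma incidenceU1 A s t :
  s \notin A -> incidence (s |: A) t = (-1) ^+ (s < t)%N * incidence A t.
Proof.
move=> sA; rewrite /incidence -exprD; congr (_ ^+ _).
case: ltnP => st.
  have -> : [set u in s |: A | (u < t)%N] = s |: [set u in A | (u < t)%N].
    by apply/setP => u; rewrite !inE; case: eqP => // ->; rewrite st.
  by rewrite cardsU1 inE (negPf sA).
rewrite add0n; apply: eq_card => u; rewrite !inE.
by case: eqP => // ->; rewrite ltnNge st !andbF.
Qed.

Lemma contractD t b c : contract t (b + c) = contract t b + contract t c.
Proof. by apply/ffunP => A; rewrite !ffunE; case: ifP; rewrite ?addr0 ?mulrDr. Qed.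

Lemma contractN t c : contract t (- c) = - contract t c.
Proof. by apply/ffunP => A; rewrite !ffunE; case: ifP; rewrite ?oppr0 ?mulrN. Qed.

Lemma contract0 t : contract t 0 = 0.
Proof. by apply/ffunP => A; rewrite !ffunE; case: ifP; rewrite ?mulr0. Qed.

Lemma contract_sum t (I : finType) (f : I -> chain) :
  contract t (\sum_i f i) = \sum_i contract t (f i).
Proof. by apply: (big_morph _ (contractD t) (contract0 t)). Qed.

Lemma bdD b c : bd (b + c) = bd b + bd c.
Proof. by rewrite /bd -big_split; apply: eq_bigr => t _; apply: contractD. Qed.

Lemma bdN c : bd (- c) = - bd c.
Proof. by rewrite /bd -sumrN; apply: eq_bigr => t _; apply: contractN. Qed.

Lemma bd0 : bd 0 = 0.
Proof. by rewrite /bd big1 // => t _; apply: contract0. Qed.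

Lemma bdE c A : bd c A = \sum_(t | t \notin A) incidence A t * c (t |: A).
Proof.
rewrite sum_ffunE [RHS]big_mkcond; apply: eq_bigr => t _.
by rewrite ffunE; case: ifP.
Qed.

Lemma contractC s t c : contract s (contract t c) = - contract t (contract s c).
Proof.
apply/ffunP => A; rewrite !ffunE !in_setU1 eq_sym.
have [sA|sA] := boolP (s \in A); have [tA|tA] := boolP (t \in A);
  rewrite ?orbT ?orbF ?mulr0 ?oppr0 //.
case: eqP => [_|/eqP st]; first by rewrite !mulr0 oppr0.
rewrite !incidenceU1 // setUCA.
have st' : (s != t :> nat) := st.
case: ltngtP st' => // _ _; rewrite /= expr0 expr1; ring.
Qed.

Lemma contract_contract t c : contract t (contract t c) = 0.
Proof.
by apply/ffunP => A; rewrite !ffunE setU11 mulr0; case: ifP.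
Qed.

Lemma contract_bd t c : contract t (bd c) = - bd (contract t c).
Proof.
by rewrite contract_sum -sumrN; apply: eq_bigr => s _; apply: contractC.
Qed.

(** Contractions anticommute, so the terms of [(s, t)] and [(t, s)] cancel and the diagonal ones
    vanish. *)
Lemma bd_bd c : bd (bd c) = 0.
Proof.
rewrite {1}/bd.
under eq_bigr do rewrite /bd contract_sum.
rewrite pair_big /=.
rewrite (bigID (fun p : 'I_n * 'I_n => (p.1 < p.2)%N)) /=.
rewrite [X in _ + X](bigID (fun p : 'I_n * 'I_n => p.1 == p.2)) /=.
rewrite [X in _ + (X + _)]big1 ?add0r; last first.
  by case=> s t /andP[_ /eqP /= ->]; apply: contract_contract.
rewrite [X in _ + X](reindex_inj (h := fun p => (p.2, p.1))) /=; last first.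
  by move=> [a1 a2] [b1 b2] [-> ->].
rewrite [X in _ + X](eq_bigl (fun p : 'I_n * 'I_n => (p.1 < p.2)%N)); last first.
  by case=> a b /=; rewrite -leqNgt eq_sym ltn_neqAle andbC.
by rewrite -big_split /= big1 // => -[s t] _; rewrite /= contractC addNr.
Qed.

Lemma contract_join v c A : v \notin A -> contract v (join v c) A = c A.
Proof.
by move=> vA; rewrite !ffunE (negPf vA) setU11 setU1K // mulrA incidence_sq mul1r.
Qed.

Lemma contract_contract_join v c A : contract v (contract v (join v c)) A = 0.
Proof. by rewrite contract_contract ffunE. Qed.

Lemma bd_join v c A : v \notin A -> bd (join v c) A = c A.
Proof.
move=> vA; rewrite sum_ffunE (bigD1 v) //= contract_join // big1 ?addr0 // => t tv.
rewrite !ffunE; case: ifP => // _.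
by rewrite in_setU1 eq_sym (negPf tv) (negPf vA) mulr0.
Qed.

Lemma chain_eq v b c : (forall A, v \notin A -> b A = c A) ->
  contract v b = contract v c -> b = c.
Proof.
move=> e /ffunP ec; apply/ffunP => A; have [vA|/e//] := boolP (v \in A).
have := ec (A :\ v); rewrite !ffunE !inE eqxx /= setD1K //.
move/(congr1 ( *%R (incidence (A :\ v) v))).
by rewrite !mulrA incidence_sq !mul1r.
Qed.

Lemma contract_eq0P v c : contract v c = 0 <-> (forall A, v \in A -> c A = 0).
Proof.
split=> [e A vA | e].
  have := congr1 (fun f : chain => f (A :\ v)) e.
  rewrite !ffunE !inE eqxx /= setD1K // => /eqP.
  by rewrite mulf_eq0 signr_eq0 => /eqP.
by apply/ffunP => A; rewrite !ffunE e ?setU11 // mulr0; case: ifP.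
Qed.

(* The faces of size [i] of the complex of those [A] with [P (W :\: A)]; it
   computes the Koszul homology, in multidegree [W], of the squarefree monomial
   ideal whose squarefree monomials are the sets satisfying [P]. *)
Definition face P W i A := [&& A \subset W, P (W :\: A) & #|A| == i].

Definition supported P W i c := forall A, c A != 0 -> face P W i A.

(** Faces are graded by cardinality and the empty face counts, so this is the vanishing of reduced
    homology in dimension [i - 1]. *)
Definition exact P W i := forall c, supported P W i c -> bd c = 0 ->
  exists2 b, supported P W i.+1 b & bd b = c.

Definition colon v P : pred {set 'I_n} := fun U => P (v |: U).

Definition monotone P := forall U U', U \subset U' -> P U -> P U'.

Lemma monotone_colon v P : monotone P -> monotone (colon v P).
Proof. by move=> mP U U' sUU'; apply: mP; apply: setUS. Qed.

Lemma supportedD P W i b c :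
  supported P W i b -> supported P W i c -> supported P W i (b + c).
Proof.
move=> sb sc A; rewrite ffunE; have [bA|/sb //] := eqVneq (b A) 0.
by rewrite bA add0r; apply: sc.
Qed.

Lemma supportedN P W i c : supported P W i c -> supported P W i (- c).
Proof. by move=> sc A; rewrite ffunE oppr_eq0; apply: sc. Qed.

Lemma supported0 P W i : supported P W i 0.
Proof. by move=> A; rewrite ffunE eqxx. Qed.

Lemma eq_face P P' W i : (forall U, U \subset W -> P U = P' U) ->
  face P W i =1 face P' W i.
Proof. by move=> e A; rewrite /face e ?subsetDl. Qed.

Lemma eq_exact P P' W i : (forall U, U \subset W -> P U = P' U) ->
  exact P W i -> exact P' W i.
Proof.
move=> e ex c sc; case/ex => [A /sc|b sb bc]; first by rewrite (eq_face _ e).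
by exists b => // A /sb; rewrite (eq_face _ e).
Qed.

Lemma exact_void P W i : (forall U, U \subset W -> ~~ P U) -> exact P W i.
Proof.
move=> e c sc _; exists 0; first exact: supported0.
rewrite bd0; apply/ffunP => A; rewrite ffunE; apply/esym/eqP.
by apply/negPn/negP => /sc /and3P[_]; rewrite (negPf (e _ (subsetDl _ _))).
Qed.

(** Deleting an element of a face [A] enlarges [W :\: A], so an upward closed [P] still holds
    there. *)
Lemma supported_bd P W i c : monotone P ->
  supported P W i.+1 c -> supported P W i (bd c).
Proof.
move=> mP sc A; rewrite bdE => nz.
have /existsP [t /andP[tA ct]] : [exists t, (t \notin A) && (c (t |: A) != 0)].
  apply: contra_neqT nz => /existsPn h; apply: big1 => t tA.
  by have := h t; rewrite tA /= negbK => /eqP ->; rewrite mulr0.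
have /and3P[sAW PA /eqP cA] := sc _ ct.
move: cA; rewrite cardsU1 tA add1n => -[cA].
apply/and3P; split; last by rewrite cA.
  by apply: subset_trans sAW; apply: subsetUr.
by apply: mP PA; apply: setDS; apply: subsetUr.
Qed.

(** * Splitting off a vertex: link and deletion *)

Section Vertex.
Variables (v : 'I_n) (W : {set 'I_n}).
Hypothesis vW : v \in W.

Lemma setU1_setD1_setD A : v \notin A -> v |: (W :\ v :\: A) = W :\: A.
Proof.
move=> vA; apply/setP => u; rewrite !inE; case: eqP => [->|_] //=.
by rewrite vA vW.
Qed.

Lemma setD_setU1 A : W :\: (v |: A) = W :\ v :\: A.
Proof. by apply/setP => u; rewrite !inE negb_or; case: eqP => //=; rewrite andbF. Qed.

Lemma face_link P i A : v \notin A -> face P (W :\ v) i A = face P W i.+1 (v |: A).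
Proof.
by move=> vA; rewrite /face setD_setU1 subsetD1 vA andbT subUset sub1set vW
  cardsU1 vA eqSS.
Qed.

Lemma face_linkN P i A : face P (W :\ v) i A -> v \notin A.
Proof. by case/and3P; rewrite subsetD1 => /andP[]. Qed.

Lemma face_deletion P i A :
  face (colon v P) (W :\ v) i A = (v \notin A) && face P W i A.
Proof.
rewrite /face /colon subsetD1; case: (boolP (v \in A)) => vA /=.
  by rewrite andbF.
by rewrite setU1_setD1_setD ?andbT.
Qed.

Lemma supported_contract P i c :
  supported P W i.+1 c -> supported P (W :\ v) i (contract v c).
Proof.
move=> sc A; rewrite ffunE; case: (boolP (v \in A)) => [_|vA]; first by rewrite eqxx.
by rewrite mulf_eq0 signr_eq0 => /sc; rewrite face_link.
Qed.

Lemma supported_join P i c :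
  supported P (W :\ v) i c -> supported P W i.+1 (join v c).
Proof.
move=> sc A; rewrite ffunE; case: ifP => [vA|_]; last by rewrite eqxx.
rewrite mulf_eq0 signr_eq0 => /sc; rewrite face_link ?inE ?eqxx //.
by rewrite setD1K.
Qed.

Lemma supported_deletion P i c :
  supported P W i c -> contract v c = 0 -> supported (colon v P) (W :\ v) i c.
Proof.
move=> sc /contract_eq0P e A nz; rewrite face_deletion sc // andbT.
by apply: contraNN nz => /e ->.
Qed.

Lemma deletion_supported P i c :
  supported (colon v P) (W :\ v) i c -> supported P W i c.
Proof. by move=> sc A /sc; rewrite face_deletion => /andP[]. Qed.

Lemma contract_deletion P i c :
  supported (colon v P) (W :\ v) i c -> contract v c = 0.
Proof.
move=> sc; apply/contract_eq0P => A vA; apply/eqP; apply/negPn/negP.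
by move=> /sc; rewrite face_deletion vA.
Qed.

Lemma contract_joinK P i c :
  supported P (W :\ v) i c -> contract v (join v c) = c.
Proof.
move=> sc; apply/ffunP => A; have [vA|] := boolP (v \in A); last exact: contract_join.
rewrite ffunE vA; apply/esym/eqP; apply/negPn/negP => /sc /face_linkN.
by rewrite vA.
Qed.

(** The only face of size 0 is the empty one, which avoids [v] and so lies in the deletion. *)
Lemma exact0_vertex P : exact (colon v P) (W :\ v) 0 -> exact P W 0.
Proof.
move=> ex c sc bc.
have [|b sb <-] := ex c _ bc; last by exists b => //; apply: deletion_supported.
move=> A cA; have fA := sc _ cA; rewrite face_deletion fA andbT.
by case/and3P: fA => _ _; rewrite cards_eq0 => /eqP ->; rewrite inE.
Qed.

(** The part of the cycle through [v] is filled in the link by [b1]; adding [bd (join v b1)] then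
    moves the cycle into the deletion. *)
Lemma exact_vertex P i : monotone P ->
  exact P (W :\ v) i -> exact (colon v P) (W :\ v) i.+1 -> exact P W i.+1.
Proof.
move=> mP exl exd c sc bc.
have [|b1 sb1 eb1] := exl _ (supported_contract sc).
  by apply/eqP; rewrite -oppr_eq0 -contract_bd bc contract0.
have sj := supported_join sb1.
have [||b2 sb2 eb2] := exd (c + bd (join v b1)).
- apply: supported_deletion; first by apply: supportedD => //; apply: supported_bd.
  by rewrite contractD contract_bd (contract_joinK sb1) eb1 subrr.
- by rewrite bdD bc bd_bd addr0.
exists (b2 - join v b1).
  by apply: supportedD; [apply: deletion_supported | apply: supportedN].
by rewrite bdD bdN eb2 addrK.
Qed.

(** A filling in the whole complex may use faces through [v]. Its contraction is a cycle of the
    link, and a filling of that cycle corrects it by a boundary. *)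
Lemma exact_deletion P i : monotone P ->
  exact P (W :\ v) i -> exact P W i -> exact (colon v P) (W :\ v) i.
Proof.
move=> mP exl ex c sc bc.
have [b sb eb] := ex c (deletion_supported sc) bc.
have [|b1 sb1 eb1] := exl _ (supported_contract sb).
  by apply/eqP; rewrite -oppr_eq0 -contract_bd eb (contract_deletion sc).
have sj := supported_join sb1.
exists (b + bd (join v b1)); last by rewrite bdD bd_bd addr0.
apply: supported_deletion; first by apply: supportedD => //; apply: supported_bd.
by rewrite contractD contract_bd (contract_joinK sb1) eb1 subrr.
Qed.

(** The connecting map sends [c] to [bd (join v c)]. If [b] fills this in the deletion, then
    [join v c - b] is a cycle; contracting a filling of it by [v] fills [c] up to sign. *)
Lemma exact_link P i : monotone P ->
  exact (colon v P) (W :\ v) i -> exact P W i.+1 -> exact P (W :\ v) i.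
Proof.
move=> mP exd ex c sc bc.
have sj := supported_join sc.
have [||b sb eb] := exd (bd (join v c)); last first.
- have [||b2 sb2 eb2] := ex (join v c - b).
  + by apply: supportedD => //; apply: supportedN; apply: deletion_supported.
  + by rewrite bdD bdN eb subrr.
  exists (- contract v b2); first by apply: supportedN; apply: supported_contract.
  rewrite bdN -contract_bd eb2 contractD contractN (contract_deletion sb).
  by rewrite subr0 (contract_joinK sc).
- exact: bd_bd.
apply: supported_deletion; first exact: supported_bd.
by rewrite contract_bd (contract_joinK sc) bc oppr0.
Qed.

(** The complex is a cone with apex [v], and [join v] is a contracting homotopy on cycles. *)
Lemma exact_cone P i : (forall U, U \subset W :\ v -> P (v |: U) = P U) ->
  exact P W i.
Proof.
move=> cone c sc bc; exists (join v c).
  move=> A; rewrite ffunE; case: ifP => [vA|_]; last by rewrite eqxx.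
  rewrite mulf_eq0 signr_eq0 => /sc /and3P[sAW PA cA].
  rewrite -(setD1K vA) -face_link ?inE ?eqxx // /face cA andbT setSD //=; last first.
    by rewrite -(setD1K vA) subUset sub1set vW.
  by rewrite -cone ?subsetDl // setU1_setD1_setD // !inE eqxx.
apply: (@chain_eq v) => [A vA|]; first exact: bd_join.
rewrite contract_bd; apply/ffunP => A.
case: (boolP (v \in A)) => vA.
  rewrite [RHS]ffunE vA ffunE bdE big1 ?oppr0 // => t tA.
  by rewrite ffunE in_setU1 vA orbT mulr0.
(* Evaluating [bd c = 0] at [A] expresses the term [t = v], which is [contract v c A], by the other
   terms. *)
have /ffunP/(_ A) := bc; rewrite [X in _ = X]ffunE sum_ffunE (bigD1 v) //= => /eqP.
rewrite addr_eq0 => /eqP ->; rewrite ffunE sum_ffunE (bigD1 v) //=.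
rewrite contract_contract_join add0r; congr (- _); apply: eq_bigr => t tv.
rewrite ffunE [RHS]ffunE; case: ifP => // _; congr (_ * _).
by apply: contract_join; rewrite in_setU1 eq_sym (negPf tv).
Qed.

End Vertex.

(** The regularity bound [r], read in the single multidegree [W] of total degree [#|W|]. *)
Definition vanishes P W r := forall i, (i + r < #|W|)%N -> exact P W i.

Lemma vanishes_le P W r r' : (r <= r')%N -> vanishes P W r -> vanishes P W r'.
Proof. by move=> rr' h i ri; apply: h; apply: leq_ltn_trans ri; rewrite leq_add2l. Qed.

Lemma eq_vanishes P P' W r : (forall U, U \subset W -> P U = P' U) ->
  vanishes P W r -> vanishes P' W r.
Proof. by move=> e h i /h; apply: eq_exact. Qed.

(** The link lowers both the homological index and the degree, which keeps the bound; the deletion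
    lowers only the degree, so its bound must be one smaller. *)
Lemma vanishes_vertex P W v r : monotone P -> v \in W ->
  vanishes P (W :\ v) r.+1 -> vanishes (colon v P) (W :\ v) r ->
  vanishes P W r.+1.
Proof.
move=> mP vW hl hd [|i]; rewrite (cardsD1 v W) vW add1n => lt.
  by apply: (exact0_vertex vW); apply: hd; rewrite add0n -ltnS.
by apply: (exact_vertex vW) => //; [apply: hl | apply: hd; rewrite -ltnS -addnS].
Qed.

End Chains.

(** * Graded Betti numbers of squarefree monomial ideals *)

Section Koszul.
Variables (F : fieldType) (n : nat) (P : pred {set 'I_n}).
Hypothesis mP : monotone P.
Implicit Types (A U W : {set 'I_n}) (t v : 'I_n) (i j : nat).

(** A squarefree monomial ideal contains a monomial exactly when it contains its radical, so the
    support decides. *)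
Definition mon_ideal (m : 'I_n -> nat) : bool := P [set v | 0 < m v].

Section Degree.
Variable j : nat.
Local Notation expo := {ffun 'I_n -> 'I_j.+1}.
Local Notation basis := ({set 'I_n} * {ffun 'I_n -> 'I_j.+1})%type.
Local Notation rowvec := 'rV[F]_(#|{: {set 'I_n} * {ffun 'I_n -> 'I_j.+1}}|).
Local Notation valid := (kvalid mon_ideal).
Local Notation koszul := (koszul_mx F mon_ideal).
Implicit Types (a m : expo) (u w : rowvec).

(** The basis element [(A, m)] has multidegree [expo_add m A], and [expo_sub a A] recovers the
    monomial from the multidegree [a]. *)
Definition expo_sub a A : expo := [ffun v => inord (a v - (v \in A))].
Definition expo_add m A : expo := [ffun v => inord (m v + (v \in A))].
Definition degree a := \sum_v (a v : nat).
Definition expo_supp a := [set v | 0 < a v].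
(** After [A] is subtracted from [a], the support is [expo_supp a :\: A] together with all places
    where [a] exceeds 1. *)
Definition ideal_at a : pred {set 'I_n} := fun U => P (U :|: [set v | 1 < a v]).

Lemma expo_subE a A v : expo_sub a A v = a v - (v \in A) :> nat.
Proof. by rewrite ffunE inordK // (leq_ltn_trans (leq_subr _ _)). Qed.

Lemma sum_mem A : \sum_v (v \in A : nat) = #|A|.
Proof. by rewrite -sum1_card [RHS]big_mkcond; apply: eq_bigr => v _; case: (v \in A). Qed.

Lemma expo_supp_le a A v : A \subset expo_supp a -> (v \in A) <= a v.
Proof. by move=> /subsetP sA; case: (boolP (v \in A)) => // /sA; rewrite inE. Qed.

Lemma degree_sub a A : A \subset expo_supp a ->
  degree (expo_sub a A) = degree a - #|A|.
Proof.
move=> sA; rewrite -sum_mem /degree -sumnB => [|v _]; last exact: expo_supp_le.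
by apply: eq_bigr => v _; apply: expo_subE.
Qed.

Lemma card_le_degree a A : A \subset expo_supp a -> #|A| <= degree a.
Proof. by move=> sA; rewrite -sum_mem; apply: leq_sum => v _; apply: expo_supp_le. Qed.

Lemma face_valid a i A : degree a = j ->
  face (ideal_at a) (expo_supp a) i A =
  (A \subset expo_supp a) && valid i j (A, expo_sub a A).
Proof.
move=> da; rewrite /face /kvalid /=; case: (boolP (A \subset _)) => //= sA.
rewrite -/(degree _) degree_sub // da andbC.
case: eqP => //= <-; rewrite -{1}da card_le_degree // eqxx /=.
congr (P _); apply/setP => v; rewrite !inE expo_subE.
have := expo_supp_le v sA; case: (v \in A); case: (nat_of_ord (a v)) => [|[|k]] //=.
Qed.

Lemma expo_addP i A m : valid i j (A, m) ->
  [/\ degree (expo_add m A) = j, A \subset expo_supp (expo_add m A) &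
      expo_sub (expo_add m A) A = m].
Proof.
case/and4P => /= /eqP cA ij /eqP dm _.
have addE v : expo_add m A v = m v + (v \in A) :> nat.
  rewrite ffunE inordK // ltnS.
  (* A valid [m] has degree [j - i] and [A] has [i] elements, so the sum stays at most [j] and
     [inord] loses nothing. *)
  apply: leq_trans (_ : j - i + i <= j); last by rewrite subnK.
  rewrite -dm leq_add //.
    by rewrite (bigD1 v) //= leq_addr.
  by case: (boolP (v \in A)) => // vA; rewrite -cA; apply/card_gt0P; exists v.
split.
- rewrite /degree (eq_bigr _ (fun v _ => addE v)) big_split /= sum_mem cA dm.
  by rewrite subnK.
- by apply/subsetP => v vA; rewrite inE addE vA addn1.
- by apply/ffunP => v; apply: val_inj; rewrite /= expo_subE addE addnK.
Qed.

Lemma expo_subK a A : A \subset expo_supp a -> expo_add (expo_sub a A) A = a.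
Proof.
move=> sA; apply/ffunP => v; apply: val_inj; rewrite ffunE expo_subE.
by rewrite subnK ?expo_supp_le //= inordK.
Qed.

Local Open Scope ring_scope.

Definition coef u (b : basis) : F := u ord0 (enum_rank b).

(** The component of multidegree [a] of a row vector. *)
Definition strand i a u : {ffun {set 'I_n} -> F} :=
  [ffun A => if face (ideal_at a) (expo_supp a) i A
             then coef u (A, expo_sub a A) else 0].

Definition valid_row i u := forall b, coef u b != 0 -> valid i j b.

Lemma monotone_ideal_at a : monotone (ideal_at a).
Proof. by move=> U U' sU; apply: mP; apply: setSU. Qed.

Lemma supported_strand i a u :
  supported (ideal_at a) (expo_supp a) i (strand i a u).
Proof. by move=> A; rewrite ffunE; case: ifP => //; rewrite eqxx. Qed.

Lemma coef_inj u w : (forall b, coef u b = coef w b) -> u = w.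
Proof. by move=> e; apply/rowP => k; have := e (enum_val k); rewrite /coef enum_valK. Qed.

Lemma coef_strand i u A m : valid i j (A, m) ->
  coef u (A, m) = strand i (expo_add m A) u A.
Proof.
move=> vA; have [d s e] := expo_addP vA.
by rewrite ffunE face_valid // s e vA.
Qed.

Lemma strand_inj i u w : valid_row i u -> valid_row i w ->
  (forall a, degree a = j -> strand i a u = strand i a w) -> u = w.
Proof.
move=> vu vw e; apply: coef_inj => -[A m].
have [v|nv] := boolP (valid i j (A, m)).
  by rewrite !(coef_strand _ v) e //; case: (expo_addP v).
have z x : valid_row i x -> coef x (A, m) = 0.
  by move=> vx; apply/eqP; apply: contraNT nv; apply: vx.
by rewrite !z.
Qed.

Lemma coef_koszul i u b' :
  coef (u *m koszul i j) b' = \sum_b coef u b * kentry F mon_ideal i j b b'.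
Proof.
rewrite /coef mxE [RHS](reindex (@enum_val _ [in {: basis}])) /=; last first.
  exact/onW_bij/enum_val_bij.
by apply: eq_bigr => k _; rewrite mxE enum_valK enum_rankK.
Qed.

Lemma valid_koszul i u : valid_row i (u *m koszul i.+1 j).
Proof.
move=> b'; rewrite coef_koszul; apply: contraR => nv.
by rewrite big1 // => b _; rewrite /kentry /= (negPf nv) andbF mulr0.
Qed.

Lemma valid_row0 i : valid_row i 0.
Proof. by move=> b; rewrite /coef mxE eqxx. Qed.

Lemma strand0 i a : strand i a 0 = 0.
Proof. by apply/ffunP => A; rewrite !ffunE /coef mxE; case: ifP. Qed.

(* The summand of [kentry] indexed by [t] only survives at the basis element
   [(t |: A, a - (t |: A))]. *)
Lemma strand_koszul i a u : degree a = j ->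
  strand i a (u *m koszul i.+1 j) = bd (strand i.+1 a u).
Proof.
move=> da; apply/ffunP => A; rewrite ffunE; case: ifP => fA; last first.
  apply/esym/eqP; apply: contraFT fA.
  exact: (supported_bd (@monotone_ideal_at a) (@supported_strand i.+1 a u)).
have := fA; rewrite face_valid // => /andP[sA vA].
rewrite coef_koszul bdE.
transitivity (\sum_b \sum_(t | [&& valid i.+1 j b, t \in b.1, A == b.1 :\ t &
    [forall v, (expo_sub a A v : nat) == ((b.2 v : nat) + (v == t))%N]])
    coef u b * incidence F b.1 t).
  apply: eq_bigr => b _; rewrite /kentry /= vA andbT.
  case: (valid i.+1 j b); last by rewrite mulr0 big_pred0.
  by rewrite mulr_sumr.
rewrite (exchange_big_dep xpredT) //= [RHS]big_mkcond; apply: eq_bigr => t _.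
have [tA|tA] /= := boolP (t \in A).
  rewrite big_pred0 // => b; apply/negbTE; apply: contraL tA => /and4P[_ _ /eqP -> _].
  by rewrite !inE eqxx.
rewrite ffunE face_valid // subUset sub1set sA andbT.
have [ta|ta] /= := boolP (t \in expo_supp a); last first.
  rewrite mulr0 big_pred0 // => b; apply/negbTE; apply: contraNN ta.
  case/and4P => _ _ _ /forallP/(_ t); rewrite expo_subE eqxx (negPf tA) subn0 inE.
  by move/eqP ->; rewrite addn1.
set b0 := (t |: A, expo_sub a (t |: A)).
have only (b : basis) : (t \in b.1) && (A == b.1 :\ t) && [forall v, (expo_sub a A v : nat)
    == ((b.2 v : nat) + (v == t))%N] = (b == b0).
  apply/idP/eqP => [|->].
    case: b => B m /= /andP[/andP[tB /eqP eA] /forallP em].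
    congr (_, _); first by rewrite eA setD1K.
    apply/ffunP => v; apply: val_inj; rewrite /= expo_subE in_setU1.
    have /eqP := em v; rewrite expo_subE; case: eqP => [->|_] /= e.
      by rewrite subn1; move: e; rewrite (negPf tA) subn0 addn1 => ->.
    by rewrite e addn0.
  rewrite /= setU11 setU1K // eqxx /=; apply/forallP => v.
  rewrite !expo_subE in_setU1; have [->|_] /= := eqVneq v t; last by rewrite addn0.
  by rewrite (negPf tA) subn0 subnK //; move: ta; rewrite inE.
rewrite (eq_bigl (fun b => valid i.+1 j b && (b == b0))); last first.
  by move=> b; rewrite -only !andbA.
case: ifP => vb0.
  rewrite (big_pred1 b0) => [|b]; last first.
    by rewrite andbC; apply: andb_idr => /eqP ->.
  (* The sign of [kentry] counts in [t |: A], that of [bd] in [A]; they agree because [t] is not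
     below itself. *)
  by rewrite mulrC incidenceU1 // ltnn mul1r.
rewrite mulr0 big_pred0 // => b; rewrite andbC.
by case: eqP => //= ->.
Qed.

Lemma koszul0 : koszul 0 j = 0.
Proof. by apply/matrixP => k l; rewrite !mxE /kentry. Qed.

Lemma koszul_koszul i : koszul i.+1 j *m koszul i j = 0.
Proof.
case: i => [|i]; first by rewrite koszul0 mulmx0.
apply/row_matrixP => k; rewrite row_mul row0.
apply: (@strand_inj i); [exact: valid_koszul | exact: valid_row0 |].
by move=> a da; rewrite strand0 !rowE !strand_koszul // bd_bd.
Qed.

Definition koszul_exact i := forall u, valid_row i u -> u *m koszul i j = 0 ->
  (u <= koszul i.+1 j)%MS.

(** The differential preserves multidegrees, so the degree [j] part is the direct sum of its
    strands. *)
Lemma koszul_exactP i : koszul_exact i <->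
  (forall a, degree a = j -> exact F (ideal_at a) (expo_supp a) i).
Proof.
split=> [ex a da c sc bc | ex u vu uX].
  (* [c] is placed in multidegree [a], with zero in all others. *)
  pose u : rowvec := \row_k
    let b : basis := enum_val k in
    if valid i j b && (expo_add b.2 b.1 == a) then c b.1 else 0.
  have coefu b : coef u b = if valid i j b && (expo_add b.2 b.1 == a) then c b.1 else 0.
    by rewrite /coef mxE enum_rankK.
  have strandu a' : degree a' = j -> strand i a' u = if a' == a then c else 0.
    move=> da'; apply/ffunP => A; rewrite ffunE coefu /=.
    case: ifP => fA; last first.
      case: eqP => [e|_]; last by rewrite ffunE.
      apply/esym/eqP; move: fA; rewrite e; apply: contraFT; exact: sc.
    move: fA; rewrite face_valid // => /andP[sA ->]; rewrite expo_subK //=.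
    by case: ifP => // _; rewrite ffunE.
  have [||w ew] := submxP (ex u _ _).
  - by move=> b; rewrite coefu; case: ifP => [/andP[]//|_]; rewrite eqxx.
  - case: i {ex} sc bc @u coefu strandu => [|i] sc bc u coefu strandu.
      by rewrite koszul0 mulmx0.
    apply: (@strand_inj i); [exact: valid_koszul | exact: valid_row0 |].
    move=> a' da'; rewrite strand0 strand_koszul // strandu //.
    by case: ifP => // _; rewrite bd0.
  exists (strand i.+1 a w); first exact: supported_strand.
  by rewrite -strand_koszul // -ew strandu // eqxx.
(* Fillings are chosen for all multidegrees at once, with value 0 outside degree [j]; [w] glues them
   into one row. *)
have [b hb] : exists b : expo -> {ffun {set 'I_n} -> F}, forall a, degree a = j ->
    supported (ideal_at a) (expo_supp a) i.+1 (b a) /\ bd (b a) = strand i a u.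
  apply: (@fin_all_exists _ (fun=> {ffun {set 'I_n} -> F}) (fun (a : expo) c =>
    degree a = j -> supported (ideal_at a) (expo_supp a) i.+1 c /\
    bd c = strand i a u)) => a.
  have [da|nda] := eqVneq (degree a) j; last by exists 0 => da; rewrite da eqxx in nda.
  have [||b sb bb] := ex a da (strand i a u); last by exists b.
    exact: supported_strand.
  case: i {ex} vu uX => [|i] vu uX; last by rewrite -strand_koszul // uX strand0.
  apply/ffunP => A; rewrite bdE ffunE big1 // => t tA.
  by rewrite ffunE /face cardsU1 tA !andbF mulr0.
pose w : rowvec := \row_k let x : basis := enum_val k in b (expo_add x.2 x.1) x.1.
apply/submxP; exists w; apply: (@strand_inj i) => //; first exact: valid_koszul.
move=> a da; have [sb <-] := hb a da; rewrite strand_koszul //; congr (bd _).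
apply/ffunP => A; rewrite ffunE /coef mxE enum_rankK /=.
case: ifP => fA; last by apply/eqP; apply: contraFT fA; apply: sb.
by move: fA; rewrite face_valid // => /andP[sA _]; rewrite expo_subK.
Qed.

(** The rows of [E] span the true chain group. By rank-nullity [s - \rank X] is the dimension of its
    cycles, which contain the rows of [Y]; the truncated difference is 0 exactly when [Y] exhausts
    them. *)
Lemma homology_rank s N (E : 'M[F]_(s, N)) (X Y : 'M[F]_N) :
  row_free E -> \rank (E *m X) = \rank X -> (Y <= E)%MS -> Y *m X = 0 ->
  (s - \rank X - \rank Y == 0)%N = (E :&: kermx X <= Y)%MS.
Proof.
move=> /eqP rE rEX sYE YX.
rewrite -{1}rE -(mxrank_mul_ker E X) rEX addKn subn_eq0.
have sY : (Y <= E :&: kermx X)%MS by rewrite sub_capmx sYE; apply/sub_kermxP.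
by rewrite -(geq_leqif (mxrank_leqif_sup sY)).
Qed.

Lemma betti_koszul_exact i : betti F mon_ideal i j = 0%N <-> koszul_exact i.
Proof.
set S := [set b : basis | valid i j b].
(* [E] selects the valid basis elements. The rows of [koszul_mx] at invalid pairs are zero, so
   restricting to [E] keeps its rank. *)
pose E : 'M[F]_(#|S|, #|{: basis}|) :=
  \matrix_(k, l) (enum_val k == enum_val l)%:R.
have EE : E *m E^T = 1%:M.
  apply/matrixP => k l; rewrite !mxE.
  rewrite (bigD1 (enum_rank (enum_val k))) //= !mxE enum_rankK eqxx mul1r.
  rewrite big1 ?addr0 => [|x xk]; first by rewrite (inj_eq enum_val_inj) eq_sym.
  rewrite !mxE; case: eqP => [e|_]; last by rewrite mul0r.
  by rewrite e enum_valK eqxx in xk.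
have inE_row (u : rowvec) : (u <= E)%MS <-> valid_row i u.
  split=> [/submxP[D ->] b|vu].
    rewrite /coef mxE; apply: contraR => nv; apply/eqP/big1 => k _.
    rewrite mxE enum_rankK; case: eqP => [e|_]; last by rewrite mulr0.
    by have := enum_valP k; rewrite e inE (negPf nv).
  apply/submxP; exists (u *m E^T); apply/rowP => l; rewrite mxE.
  have [v|nv] := boolP (enum_val l \in S).
    rewrite (bigD1 (enum_rank_in v (enum_val l))) //= big1 ?addr0 => [|k kl].
      rewrite !mxE (bigD1 l) //= !mxE enum_rankK_in // eqxx !mulr1 big1 ?addr0 //.
      by move=> x xl; rewrite !mxE enum_rankK_in // (inj_eq enum_val_inj) eq_sym
        (negPf xl) mulr0.
    rewrite [E _ _]mxE; case: eqP => [e|_]; last by rewrite mulr0.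
    by case/eqP: kl; apply: enum_val_inj; rewrite e enum_rankK_in.
  rewrite big1 => [|k _]; last first.
    rewrite [E _ _]mxE; case: eqP => [e|_]; last by rewrite mulr0.
    by rewrite -e enum_valP in nv.
  apply/eqP; apply: contraNT nv => nz; rewrite inE; apply: vu.
  by rewrite /coef enum_valK.
have rX : \rank (E *m koszul i j) = \rank (koszul i j).
  have e : E^T *m (E *m koszul i j) = koszul i j.
    rewrite mulmxA; apply/matrixP => k l; rewrite mxE (bigD1 k) //=.
    have [v|nv] := boolP (enum_val k \in S); last first.
      have z x : koszul i j k x = 0.
        by rewrite mxE /kentry; move: nv; rewrite inE => /negPf ->; rewrite !andbF.
      rewrite z mulr0 add0r big1 // => x xk; rewrite [X in X * _]mxE big1 ?mul0r // => y _.
      rewrite !mxE; case: eqP => [e|_]; last by rewrite mul0r.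
      by rewrite -e enum_valP in nv.
    rewrite mxE (bigD1 (enum_rank_in v (enum_val k))) //= !mxE enum_rankK_in // eqxx.
    rewrite mulr1 big1 ?addr0 => [|y yk]; last first.
      rewrite !mxE; case: eqP => [e|_]; last by rewrite mul0r.
      by case/eqP: yk; apply: enum_val_inj; rewrite enum_rankK_in.
    rewrite mul1r big1 ?addr0 // => x xk; rewrite mxE big1 ?mul0r // => y _.
    rewrite !mxE; case: eqP => [->|_]; last by rewrite mul0r.
    by rewrite (inj_eq enum_val_inj) eq_sym (negPf xk) mulr0.
  apply/eqP; rewrite eqn_leq mxrankM_maxr /=.
  by rewrite -{1}e mxrankM_maxr.
have fE : row_free E by apply/row_freeP; exists E^T.
have sY : (koszul i.+1 j <= E)%MS.
  apply/row_subP => k; apply/inE_row; rewrite rowE; exact: valid_koszul.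
have := homology_rank fE rX sY (koszul_koszul i).
rewrite -/(betti F mon_ideal i j) => e; split=> [b0 u vu uX | ex].
  have : (E :&: kermx (koszul i j) <= koszul i.+1 j)%MS by rewrite -e b0.
  apply: submx_trans; rewrite sub_capmx; apply/andP; split; first exact/inE_row.
  exact/sub_kermxP.
apply/eqP; rewrite [_ == _]e; apply/rV_subP => u.
rewrite sub_capmx => /andP[uE /sub_kermxP uX].
by apply: ex => //; apply/inE_row.
Qed.

End Degree.

(** Squarefree multidegrees of degree [j] are the sets [W] with [j] elements; in every other
    multidegree the complex is a cone. *)
Lemma betti_eq0P i j : betti F mon_ideal i j = 0 <->
  (forall W, #|W| = j -> exact F P W i).
Proof.
rewrite betti_koszul_exact koszul_exactP; split=> [ex W cW | ex a da].
  pose a : {ffun 'I_n -> 'I_j.+1} := [ffun v => inord (v \in W)].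
  have aE v : a v = (v \in W) :> nat.
    rewrite ffunE inordK // ltnS -cW; case: (boolP (v \in W)) => // vW.
    by apply/card_gt0P; exists v.
  have sa : expo_supp a = W.
    by apply/setP => v; rewrite inE aE; case: (v \in W).
  have := ex a; rewrite sa => exW.
  apply: (@eq_exact _ _ (ideal_at a)) => [U _|]; last first.
    by apply: exW; rewrite /degree (eq_bigr _ (fun v _ => aE v)) sum_mem cW.
  rewrite /ideal_at (_ : [set v | 1 < a v] = set0) ?setU0 //.
  by apply/setP => v; rewrite !inE aE; case: (v \in W).
(* A variable of exponent at least 2 stays in the support even after one subtraction, so it is an
   apex. *)
have [t0|[v]] := set_0Vmem [set v | 1 < a v]; last first.
  rewrite inE => av; apply: (@exact_cone _ _ v); first by rewrite inE ltnW.
  move=> U _; rewrite /ideal_at; congr (P _); apply/setP => u; rewrite !inE.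
  by have [->|_] := eqVneq u v; rewrite ?av ?orbT.
apply: (@eq_exact _ _ P) => [U _|]; first by rewrite /ideal_at t0 setU0.
apply: ex; rewrite -{2}da -sum_mem; apply: eq_bigr => v _; rewrite inE.
by have /setP/(_ v) := t0; rewrite !inE; case: (nat_of_ord (a v)) => [|[|]].
Qed.

End Koszul.

(** * Matchings and leaves in forests *)

Section Graph.
Variables (n : nat) (G : rel 'I_n).
Implicit Types (T U W e f : {set 'I_n}) (a b u v w x y z : 'I_n).
Implicit Types (M D : {set {set 'I_n}}).

(** The recursion lets inductions remove one edge at a time without handling sets of edges;
    [has_matchingE] relates it to [is_matching]. *)
Fixpoint has_matching k U : bool :=
  if k is k'.+1 then
    [exists a in U, exists b in U, G a b && has_matching k' (U :\ a :\ b)]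
  else true.

Lemma has_matchingP k U :
  reflect (exists a b, [/\ a \in U, b \in U, G a b & has_matching k (U :\ a :\ b)])
          (has_matching k.+1 U).
Proof.
apply: (iffP existsP) => [[a /andP[aU /existsP[b /and3P[bU ab h]]]]|].
  by exists a, b.
case=> a [b [aU bU ab h]]; exists a; rewrite aU /=.
by apply/existsP; exists b; rewrite bU ab.
Qed.

Lemma has_matching_mono k : monotone (has_matching k).
Proof.
elim: k => // k IHk U U' sUU' /has_matchingP[a [b [aU bU ab h]]].
apply/has_matchingP; exists a, b; rewrite !(subsetP sUU') //; split=> //.
by apply: IHk h; rewrite !setSD.
Qed.

Hypothesis Gsym : symmetric G.
Hypothesis Girr : irreflexive G.

Lemma edge_neq a b : G a b -> a != b.
Proof. by apply: contraTneq => ->; rewrite Girr. Qed.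

Lemma has_matching_card k U : has_matching k U -> k.*2 <= #|U|.
Proof.
elim: k U => // k IHk U /has_matchingP[a [b [aU bU ab /IHk]]].
rewrite (cardsD1 a U) aU (cardsD1 b (U :\ a)) !inE bU eq_sym edge_neq //=.
Qed.

Lemma has_matching_isolated k y U : (forall w, w \in U -> ~~ G y w) ->
  has_matching k (y |: U) = has_matching k U.
Proof.
move=> iso; apply/idP/idP; last exact/has_matching_mono/subsetUr.
elim: k U iso => // k IHk U iso /has_matchingP[a [b [aU bU ab h]]].
have Gy w : w \in y |: U -> G y w = false.
  by rewrite in_setU1 => /orP[/eqP->|/iso/negPf//]; rewrite Girr.
have ay : a != y by apply: contraTneq ab => ->; rewrite Gy.
have by_ : b != y by apply: contraTneq ab => ->; rewrite Gsym Gy.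
move: aU bU; rewrite !in_setU1 (negPf ay) (negPf by_) /= => aU bU.
apply/has_matchingP; exists a, b; split=> //; apply: IHk.
  by move=> w; rewrite !inE => /and3P[_ _]; apply: iso.
apply: has_matching_mono h; apply/subsetP => u; rewrite !inE.
by case: (u == y); rewrite ?orbT ?andbT //=.
Qed.

(* A matching of [U + x + y] touching [y] can be traded for one through the
   pendant edge [xy]. *)
Lemma has_matching_leaf k x y U : G x y -> x \notin U -> y \notin U ->
  (forall w, w \in U -> ~~ G x w) ->
  has_matching k.+1 (x |: (y |: U)) = has_matching k U.
Proof.
move=> xy xU yU leaf; apply/idP/idP; last first.
  move=> h; apply/has_matchingP; exists x, y; split=> //; rewrite ?inE ?eqxx ?orbT //.
  apply: has_matching_mono h; apply/subsetP => u uU; rewrite !inE uU !orbT andbT.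
  by apply/andP; split; [apply: contraNneq yU | apply: contraNneq xU] => <-.
elim: k U xU yU leaf => // k IHk U xU yU leaf /has_matchingP[a [b [aU bU ab h]]].
have Gx w : w \in x |: (y |: U) -> G x w -> w = y.
  rewrite !in_setU1 => /or3P[/eqP->|/eqP->//|/leaf/negPf->//].
  by rewrite Girr.
have [axy|] := boolP ((a == x) || (b == x)).
  apply: has_matching_mono h; apply/subsetP => u; rewrite !inE.
  have [[-> ->]|[-> ->]] : (a = x /\ b = y) \/ (a = y /\ b = x).
    case/orP: axy => /eqP e; [left|right]; move: ab; rewrite e.
      by move/(Gx _ bU).
    by rewrite Gsym => /(Gx _ aU).
  - by case: (u == x) => //=; case: (u == y).
  - by case: (u == x) => //=; case: (u == y).
rewrite negb_or => /andP[ax bx].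
have [ayb|] := boolP ((a == y) || (b == y)).
  rewrite -(@has_matching_isolated _ x) //; apply: has_matching_mono h.
  apply/subsetP => u; rewrite !inE.
  by case/orP: ayb => /eqP <-; case: (u == a); case: (u == b); rewrite ?orbF //=.
rewrite negb_or => /andP[ay by_].
move: aU bU; rewrite !in_setU1 (negPf ax) (negPf ay) (negPf bx) (negPf by_) /=.
move=> aU bU; apply/has_matchingP; exists a, b; split=> //.
apply: IHk; rewrite ?inE ?(negPf xU) ?(negPf yU) ?andbF //.
  by move=> w; rewrite !inE => /and3P[_ _]; apply: leaf.
apply: has_matching_mono h; apply/subsetP => u; rewrite !inE.
by case: (u == x) => //; case: (u == y); rewrite ?orbT ?andbT //=.
Qed.

(** * Longest paths and leaves *)

Definition chain_in W (s : seq 'I_n) :=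
  [&& uniq s, all (mem W) s & sorted G s].

Definition longest_in W s :=
  chain_in W s /\ forall s', chain_in W s' -> size s' <= size s.

Lemma longest_exists W : exists s, longest_in W s.
Proof.
pose Q k := [exists t : k.-tuple 'I_n, chain_in W t].
have Q0 : exists k, Q k by exists 0; apply/existsP; exists [tuple].
have Qn k : Q k -> k <= n.
  case/existsP => t /and3P[/card_uniqP e _ _].
  by rewrite -(size_tuple t) -e -[n in _ <= n]card_ord; apply: max_card.
have [k /existsP[t ct] max] := ex_maxnP Q0 Qn.
exists t; split=> // s cs; rewrite size_tuple; apply: max.
by apply/existsP; exists (in_tuple s).
Qed.

Hypothesis Gforest : forest G.

Lemma no_cycle c : uniq c -> 2 < size c -> ~~ cycle G c.
Proof.
move=> uc sc; apply: contraNN Gforest => cc.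
have le : size c < n.+1.
  by rewrite ltnS -(card_uniqP uc) -[n in _ <= n]card_ord max_card.
apply/existsP; exists (Ordinal le); apply/existsP; exists (in_tuple c).
by rewrite /= uc sc cc !andbT /=; apply/allP => v; rewrite inE.
Qed.

(** An edge from [x] back to [w] would close a cycle through [y], of length at least 3. *)
Lemma path_back x y p w : uniq [:: x, y & p] -> path G x (y :: p) -> w \in p ->
  ~~ G x w.
Proof.
move=> up pp wp; apply/negP => xw.
case/splitPr: wp up pp => p1 p2 up pp.
apply: (negP (@no_cycle [:: x, y & rcons p1 w] _ _)).
- move: up; rewrite -cat_rcons -!cat_cons cat_uniq => /andP[//].
- by rewrite /= size_rcons.
- rewrite /= rcons_path last_rcons (Gsym w) xw andbT.
  by move: pp; rewrite /= -cat_rcons cat_path => /and3P[-> ->].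
Qed.

(** A neighbour of [x] off the path would prolong it; one on the path beyond [y] would close a
    cycle. *)
Lemma longest_leaf W x y p w : longest_in W [:: x, y & p] -> w \in W -> G x w ->
  w = y.
Proof.
move=> [/and3P[us aW ss] max] wW xw.
have [wp|wp] := boolP (w \in [:: x, y & p]); last first.
  suff /max : chain_in W [:: w, x, y & p] by rewrite /= ltnn.
  apply/and3P; split; first by rewrite cons_uniq wp us.
    by rewrite -cat1s all_cat aW /= wW.
  by move: ss; rewrite /= (Gsym w) xw.
move: wp; rewrite !inE => /or3P[/eqP e|/eqP//|wp].
  by rewrite e Girr in xw.
by rewrite (negPf (path_back us ss wp)) in xw.
Qed.

(** The vertices [x], [y], [z] begin a longest path. Any other neighbour [w] of [y] is off the path
    from [y] on, and replacing [x] by [w] gives another longest path, so [w] is a leaf too. *)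
Lemma distant_leaf W : (exists2 a, a \in W & exists2 b, b \in W & G a b) ->
  exists x y z, [/\ x \in W, y \in W, G x y, forall w, w \in W -> G x w -> w = y &
   forall w, w \in W -> G y w -> w != z -> forall u, u \in W -> G w u -> u = y].
Proof.
case=> a aW [b bW ab]; have [s ls] := longest_exists W.
have : 1 < size s.
  case: (ls) => _ /(_ [:: a; b]); apply.
  by rewrite /chain_in /= !inE aW bW ab edge_neq.
case: s ls => [|x [|y p]] // ls _.
have [/and3P[us /and3P[xW yW aWp] /= /andP[xy yp]] max] := ls.
(* If the path ends at [y], then [z] defaults to [y], which differs from all its neighbours. *)
exists x, y, (head y p); split=> // [w|w wW yw wz]; first exact: longest_leaf ls.
have wnx: w \notin y :: p.
  apply/negP; rewrite inE => /orP[/eqP e|wp]; first by rewrite e Girr in yw.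
  case: p {ls aWp max} yp wz wp us => [|z p] //= yp wz; rewrite inE (negPf wz) /= => wp us.
  have := @path_back y z p w _ yp wp; rewrite yw /= => h.
  by move: us; rewrite -/(uniq [:: x, y, z & p]) cons_uniq => /andP[_ /h].
have lw : longest_in W [:: w, y & p].
  split; last by move=> s' /max.
  apply/and3P; split; last by rewrite /= (Gsym w) yw.
    by rewrite cons_uniq wnx; move: us; rewrite cons_uniq => /andP[].
  by apply/and3P.
by move=> u; apply: longest_leaf lw.
Qed.

End Graph.

(** * Gaps, regularity bounds and nonvanishing *)

Section Matchings.
Variables (n : nat) (G : rel 'I_n).
Hypotheses (Gsym : symmetric G) (Girr : irreflexive G).
Implicit Types (T U W e f : {set 'I_n}) (a b u v w x y z : 'I_n).
Implicit Types (M D : {set {set 'I_n}}).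

Lemma edgesP e :
  reflect (exists a b, G a b /\ e = [set a; b]) (e \in edges G).
Proof.
apply: (iffP imset2P) => [[a b _]|[a [b [ab ->]]]].
  by rewrite inE => /andP[_ ab] ->; exists a, b.
by exists a b; rewrite ?inE.
Qed.

Lemma edges_set2 x y : G x y -> [set x; y] \in edges G.
Proof. by move=> xy; apply/edgesP; exists x, y. Qed.

Lemma gapP e f :
  reflect ([disjoint e & f] /\ forall u v, u \in e -> v \in f -> ~~ G u v)
          (gap G e f).
Proof.
apply: (iffP andP) => -[d h]; split=> //.
  by move=> u v ue vf; have /forall_inP/(_ u ue)/forall_inP/(_ v vf) := h.
by apply/forall_inP => u ue; apply/forall_inP => v vf; apply: h.
Qed.

Lemma gap_sym e f : gap G e f = gap G f e.
Proof.
by apply/gapP/gapP => -[d h]; (split; first by rewrite disjoint_sym) => u v ue vf;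
  rewrite Gsym h.
Qed.

Lemma sub_cover M e : e \in M -> e \subset cover M.
Proof. exact: bigcup_sup. Qed.

Lemma card_cover_matching M : is_matching G M -> #|cover M| = #|M|.*2.
Proof.
case/andP=> sME /eqP <-; rewrite (eq_bigr (fun=> 2)) ?sum_nat_const ?muln2 //.
move=> e /(subsetP sME) /edgesP[a [b [ab ->]]].
by rewrite cards2 (edge_neq Girr ab).
Qed.

Lemma matching_sub M M' : M' \subset M -> is_matching G M -> is_matching G M'.
Proof.
move=> s /andP[sM tM]; rewrite /is_matching (subset_trans s sM) /=.
exact: trivIsetS tM.
Qed.

Lemma cover_setU1 e M : cover (e |: M) = e :|: cover M.
Proof. by rewrite /cover bigcup_setU big_set1. Qed.

Lemma matching_setU1 M x y : is_matching G M -> G x y ->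
  x \notin cover M -> y \notin cover M ->
  is_matching G ([set x; y] |: M) /\ #|[set x; y] |: M| = #|M|.+1.
Proof.
case/andP=> sM tM xy xM yM.
have s0 : set0 \notin M.
  apply/negP => /(subsetP sM) /edgesP[a [b [_ /setP/(_ a)]]].
  by rewrite !inE eqxx.
have [|tI eM] := @trivIsetU1 _ [set x; y] M _ tM s0.
  move=> f fM; rewrite disjoints_subset; apply/subsetP => u.
  rewrite !inE => /orP[] /eqP ->.
    by apply: contraNN xM => /(subsetP (sub_cover fM)).
  by apply: contraNN yM => /(subsetP (sub_cover fM)).
by rewrite /is_matching tI cardsU1 eM subUset sub1set edges_set2 // sM.
Qed.

Lemma has_matchingE k U :
  has_matching G k U =
  [exists M, [&& is_matching G M, #|M| == k & cover M \subset U]].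
Proof.
apply/idP/existsP.
  elim: k U => [|k IHk] U.
    move=> _; exists set0; rewrite /is_matching sub0set cards0 /cover big_set0.
    by rewrite sub0set !andbT; apply/trivIsetP => A B; rewrite inE.
  case/has_matchingP => a [b [aU bU ab /IHk[M /and3P[mM /eqP cM sM]]]].
  have nM v : v \notin U :\ a :\ b -> v \notin cover M.
    by apply: contraNN; apply/subsetP.
  have [||mM' cM'] := @matching_setU1 M a b mM ab.
  - by apply: nM; rewrite !inE eqxx andbF.
  - by apply: nM; rewrite !inE eqxx.
  exists ([set a; b] |: M); rewrite mM' cM' cM eqxx cover_setU1 !subUset !sub1set.
  by rewrite aU bU (subset_trans sM) // (subset_trans (subsetDl _ _)) // subsetDl.
elim: k U => // k IHk U [M /and3P[mM /eqP cM sM]].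
have /card_gt0P[e eM] : 0 < #|M| by rewrite cM.
have /andP[sE tM] := mM.
have /edgesP[a [b [ab de]]] := subsetP sE _ eM.
have seU : e \subset U by apply: subset_trans sM; apply: sub_cover.
apply/has_matchingP; exists a, b; split=> //.
- by apply: (subsetP seU); rewrite de !inE eqxx.
- by apply: (subsetP seU); rewrite de !inE eqxx orbT.
apply: IHk; exists (M :\ e); rewrite (matching_sub _ mM) ?subsetDl //=.
move: cM; rewrite (cardsD1 e) eM add1n => -[->]; rewrite eqxx /=.
apply/bigcupsP => f /setD1P[fe fM].
have dfe : [disjoint e & f] by move/trivIsetP: tM; apply=> //; rewrite eq_sym.
apply/subsetP => u uf; rewrite !inE (subsetP sM); last exact: (subsetP (sub_cover fM)).
have : u \notin e by rewrite (disjointFl dfe).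
by rewrite de !inE negb_or andbT andbC.
Qed.

(** With [#|D| <= 1] all edges form gaps pairwise; with [#|D| <= 2], [D] stands for the one block of
    two edges that 2-admissibility tolerates. *)
Definition gaps_outside D M := forall e f, e \in M -> f \in M -> e != f ->
  gap G e f || (e \in D) && (f \in D).

Definition gap_bound k W B := forall M D, is_matching G M -> cover M \subset W ->
  #|D| <= k -> gaps_outside D M -> #|M| <= B.

Lemma gap_boundS k T W B : T \subset W -> gap_bound k W B -> gap_bound k T B.
Proof. by move=> sTW h M D mM /subset_trans/(_ sTW); apply: h. Qed.

Lemma gaps_outside_set0 D : gaps_outside D set0.
Proof. by move=> e f; rewrite inE. Qed.

Lemma gap_bound_edge k k' W T x y B : gap_bound k W B ->
  T \subset W -> x \in W -> y \in W -> x \notin T -> y \notin T -> G x y ->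
  (forall M D, is_matching G M -> cover M \subset T -> #|D| <= k' ->
    gaps_outside D M ->
    exists2 D' : {set {set 'I_n}}, #|D'| <= k & gaps_outside D' ([set x; y] |: M)) ->
  exists2 B', B = B'.+1 & gap_bound k' T B'.
Proof.
move=> bW sTW xW yW xT yT xy ext.
have key M D : is_matching G M -> cover M \subset T -> #|D| <= k' ->
    gaps_outside D M -> #|M| < B.
  move=> mM sM cD gM; have [D' cD' gD'] := ext M D mM sM cD gM.
  have [||mM' <-] := @matching_setU1 M x y mM xy.
  - by apply: contraNN xT; apply/subsetP.
  - by apply: contraNN yT; apply/subsetP.
  apply: bW cD' gD' => //; rewrite cover_setU1 !subUset !sub1set xW yW.
  exact: subset_trans sTW.
(* The empty matching, extended by the edge, shows that [B] has a predecessor. *)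
have : 0 < B.
  rewrite -(cards0 {set 'I_n}); apply: (@key set0 set0).
  - by rewrite /is_matching sub0set; apply/trivIsetP => A C; rewrite inE.
  - by rewrite /cover big_set0 sub0set.
  - by rewrite cards0.
  - exact: gaps_outside_set0.
by case: B bW key => // B _ key _; exists B.
Qed.

Lemma gap_set2 T x y f : x \notin T -> y \notin T -> f \subset T ->
  (forall w, w \in f -> ~~ G x w) -> (forall w, w \in f -> ~~ G y w) ->
  gap G [set x; y] f.
Proof.
move=> xT yT sfT nx ny; apply/gapP; split.
  rewrite disjoints_subset; apply/subsetP => u; rewrite !inE => /orP[] /eqP ->.
    by apply: contraNN xT; apply/subsetP.
  by apply: contraNN yT; apply/subsetP.
by move=> u v; rewrite !inE => /orP[] /eqP ->; [apply: nx | apply: ny].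
Qed.

Lemma gaps_outside_setU1 D M e :
  (forall f, f \in M -> gap G e f || (e \in D) && (f \in D)) ->
  gaps_outside D M -> gaps_outside D (e |: M).
Proof.
move=> he hM f g /setU1P[->|fM] /setU1P[->|gM]; rewrite ?eqxx // => fg.
- exact: he.
- by rewrite gap_sym andbC; apply: he.
- exact: hM.
Qed.

Lemma gap_bound_isolated k W T x y B : gap_bound k W B ->
  T \subset W -> x \in W -> y \in W -> x \notin T -> y \notin T -> G x y ->
  (forall w, w \in T -> ~~ G x w) -> (forall w, w \in T -> ~~ G y w) ->
  exists2 B', B = B'.+1 & gap_bound k T B'.
Proof.
move=> bW sTW xW yW xT yT xy nx ny.
apply: (gap_bound_edge bW sTW xW yW xT yT xy) => M D mM sM cD gM.
exists D => //; apply: gaps_outside_setU1 => // f fM.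
have sfT : f \subset T := subset_trans (sub_cover fM) sM.
apply/orP; left; apply: (gap_set2 xT yT sfT) => w /(subsetP sfT).
  exact: nx.
exact: ny.
Qed.

(** Neighbours of [x] or [y] in [T] other than [z] are isolated in [T], so no edge of [M] covers
    them. Only the edge through [z] can fail to form a gap with the new edge, and [M] itself has no
    exceptional pair. *)
Lemma gap_bound_pendant W T x y z B : gap_bound 2 W B ->
  T \subset W -> x \in W -> y \in W -> x \notin T -> y \notin T -> G x y ->
  (forall w, w \in T -> G x w || G y w -> w != z ->
     forall u, u \in T -> ~~ G w u) ->
  exists2 B', B = B'.+1 & gap_bound 1 T B'.
Proof.
move=> bW sTW xW yW xT yT xy nz.
apply: (gap_bound_edge bW sTW xW yW xT yT xy) => M D mM sM cD gM.
(* If [M] does not cover [z], then [pblock M z] is the empty set, which is harmless here. *)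
exists [set [set x; y]; pblock M z]; first by rewrite cards2; case: eqP.
have /andP[sE tM] := mM.
apply: gaps_outside_setU1 => [f fM|e f eM fM ef]; last first.
  apply/orP; left; have /orP[//|/andP[eD fD]] := gM e f eM fM ef.
  by move/card_le1_eqP: cD => /(_ e f eD fD) h; rewrite h eqxx in ef.
have sfT : f \subset T := subset_trans (sub_cover fM) sM.
have [zf|zf] := boolP (z \in f).
  by rewrite (def_pblock tM fM zf) !inE !eqxx orbT orbT.
have n2 w : w \in f -> ~~ (G x w || G y w).
  move=> wf; apply/negP => h.
  have wz : w != z by apply: contraNneq zf => <-.
  have nw := nz w (subsetP sfT _ wf) h wz.
  have /edgesP[a [b [ab df]]] := subsetP sE _ fM.
  have aT : a \in T by apply: (subsetP sfT); rewrite df !inE eqxx.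
  have bT : b \in T by apply: (subsetP sfT); rewrite df !inE eqxx orbT.
  move: wf; rewrite df !inE => /orP[] /eqP e; rewrite -{}e in ab.
    by move: ab; rewrite (negPf (nw _ bT)).
  by move: ab; rewrite Gsym (negPf (nw _ aT)).
apply/orP; left; apply: (gap_set2 xT yT sfT) => w /n2; rewrite negb_or.
  by case/andP.
by case/andP.
Qed.

Section Vanishing.
Variable F : fieldType.
Hypothesis Gforest : forest G.
Local Notation vanishes := (@vanishes F n).

(** * Upper bound: from one matching power to the next *)

Section Step.
Variables (k : nat) (bound' bound : {set 'I_n} -> nat -> Prop).
Hypothesis bound'_vanishes :
  forall T B, bound' T B -> vanishes (has_matching G k) T (B + k).
Hypothesis boundS : forall T W B, T \subset W -> bound W B -> bound T B.
Hypothesis bound_isolated : forall W T x y B, bound W B ->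
  T \subset W -> x \in W -> y \in W -> x \notin T -> y \notin T -> G x y ->
  (forall w, w \in T -> ~~ G x w) -> (forall w, w \in T -> ~~ G y w) ->
  exists2 B', B = B'.+1 & bound T B'.
Hypothesis bound_pendant : forall W T x y z B, bound W B ->
  T \subset W -> x \in W -> y \in W -> x \notin T -> y \notin T -> G x y ->
  (forall w, w \in T -> G x w || G y w -> w != z ->
     forall u, u \in T -> ~~ G w u) ->
  exists2 B', B = B'.+1 & bound' T B'.

(** The outer induction is on [W], the inner one on the part [T] left after [y] and some of its
    neighbours. The colon by [y] lowers the bound to [B + k]; a further colon by a neighbour lowers
    it to [B' + k] with [B = B'.+1], which the lower power meets. *)
Lemma vanishes_has_matchingS W B :
  bound W B -> vanishes (has_matching G k.+1) W (B + k.+1).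
Proof.
move: {2}#|W| (leqnn #|W|) => m; elim: m W B => [|m IHm] W B.
  by rewrite leqn0 cards_eq0 => /eqP -> _ i; rewrite cards0.
move=> cW bW.
have [/existsP[a /andP[aW /existsP[b /andP[bWs ab]]]]|nE] :=
  boolP [exists a in W, exists b in W, G a b]; last first.
  move=> i _; apply: exact_void => U sUW; apply/has_matchingP => -[a [b [aU bU ab _]]].
  case/existsP: nE; exists a; rewrite (subsetP sUW) //=.
  by apply/existsP; exists b; rewrite (subsetP sUW).
have [|x [y [z [xW yW xy leaf_x leaf_y]]]] := distant_leaf Gsym Girr Gforest (W := W).
  by exists a => //; exists b.
have smaller T : T \subset W :\ y -> bound T B.
  by move=> sT; apply: boundS bW; apply: subset_trans sT (subsetDl _ _).
have card_T T : T \subset W :\ y -> #|T| <= m.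
  by move/subset_leq_card/leq_trans; apply; move: cW; rewrite (cardsD1 y) yW.
rewrite addnS; apply: (vanishes_vertex _ yW); first exact: has_matching_mono.
  by rewrite -addnS; apply: IHm; [apply: card_T | apply: smaller].
suff: forall T, T \subset W :\ y ->
    vanishes (colon y (has_matching G k.+1)) T (B + k) by apply.
move=> T; move: {2}#|T| (leqnn #|T|) => p; elim: p T => [|p IHp] T.
  by rewrite leqn0 cards_eq0 => /eqP -> _ i; rewrite cards0.
move=> cT sT.
have sTW : T \subset W := subset_trans sT (subsetDl _ _).
have yT : y \notin T by apply/negP => /(subsetP sT); rewrite !inE eqxx.
(* Here [w] is split off, while [x'] is the end of the pendant edge at [y] that lowers the bound;
   they differ when [w] is [z]. *)
have step w x' : w \in T -> G y w -> x' \in W -> G x' y -> x' \notin T :\ w ->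
    (forall u, u \in T :\ w -> G x' u || G y u -> u != z ->
      forall t, t \in T :\ w -> ~~ G u t) ->
    (forall U, U \subset T :\ w ->
      has_matching G k.+1 (y |: (w |: U)) = has_matching G k U) ->
    vanishes (colon y (has_matching G k.+1)) T (B + k).
  move=> wT yw x'W x'y x'T nz exch.
  have [||B' eB bT] := @bound_pendant W (T :\ w) x' y z B bW _ x'W yW x'T _ x'y nz.
  - by apply: subset_trans sTW; apply: subsetDl.
  - by rewrite !inE (negPf yT) andbF.
  rewrite eB addSn; apply: (vanishes_vertex _ wT).
  - exact/monotone_colon/has_matching_mono.
  - rewrite -addSn -eB; apply: IHp; last by apply: subset_trans sT; apply: subsetDl.
    by move: cT; rewrite (cardsD1 w) wT.
  - apply: eq_vanishes (bound'_vanishes bT) => U sU.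
    by rewrite /colon exch.
have [/existsP[w /and3P[wT yw wz]]|/existsPn noleaf] :=
    boolP [exists w, [&& w \in T, G y w & w != z]].
  have wW : w \in W by apply: (subsetP sTW).
  have leaf_w u : u \in T -> ~~ G w u.
    move=> uT; apply: contraNN yT => wu.
    by rewrite -(leaf_y w wW yw wz u (subsetP sTW _ uT) wu).
  apply: (step w w) => //; rewrite ?inE ?eqxx ?(Gsym w) //.
    move=> u /setD1P[uw uT] /orP[wu|yu] uz t /setD1P[tw tT].
      by rewrite (negPf (leaf_w _ uT)) in wu.
    apply: contraNN yT => ut.
    by rewrite -(leaf_y u (subsetP sTW _ uT) yu uz t (subsetP sTW _ tT) ut).
  move=> U sU; rewrite setUCA; apply: has_matching_leaf => //.
  - by rewrite Gsym.
  - by apply/negP => /(subsetP sU); rewrite !inE eqxx.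
  - by apply/negP => /(subsetP sU) /setD1P[_ /(negP yT)].
  - by move=> u /(subsetP sU) /setD1P[_]; apply: leaf_w.
have only_z w : w \in T -> G y w -> w = z.
  by move=> wT yw; have := noleaf w; rewrite wT yw /= negbK => /eqP.
(* With [z] the only neighbour left, [y] is itself a leaf at [z]: the exchange uses the edge [yz],
   the bound uses [xy]. *)
have [/andP[zT yz]|noz] := boolP ((z \in T) && G y z).
  have Gy u : u \in T :\ z -> ~~ G y u.
    by case/setD1P => uz uT; apply: contraNN uz => yu; rewrite (only_z u).
  have xT : x \notin T :\ z.
    by apply/negP => /Gy; rewrite Gsym xy.
  apply: (step z x) => //.
    move=> u uT /orP[xu|yu] uz t tT; last by rewrite (negPf (Gy _ uT)) in yu.
    move: (uT) => /setD1P[_ uT']; move: yT.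
    by rewrite -(leaf_x u (subsetP sTW _ uT') xu) uT'.
  move=> U sU; apply: has_matching_leaf => //.
  - by apply/negP => /(subsetP sU) /setD1P[_ /(negP yT)].
  - by apply/negP => /(subsetP sU); rewrite !inE eqxx.
  - by move=> u /(subsetP sU); apply: Gy.
have Gy u : u \in T -> ~~ G y u.
  by move=> uT; apply: contraNN noz => yu; rewrite -(only_z u) // uT.
have xT : x \notin T by apply/negP => /Gy; rewrite Gsym xy.
(* Now [y] is isolated, so the colon is the same power on [T]; the edge [xy], which forms a gap with
   all edges in [T], accounts for the lowered bound. *)
have [||B' eB bT] := @bound_isolated W T x y B bW sTW xW yW xT yT xy => //.
  move=> u uT; apply: contraNN yT => xu.
  by rewrite -(leaf_x u (subsetP sTW _ uT) xu).
rewrite eB addSnnS; apply: eq_vanishes (IHm T B' (card_T _ sT) bT) => U sU.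
rewrite /colon has_matching_isolated // => u /(subsetP sU); exact: Gy.
Qed.

End Step.

(** The zeroth power is the unit ideal, whose complex on a nonempty [W] is a full simplex. *)
Lemma vanishes_has_matching0 W : vanishes (has_matching G 0) W 0.
Proof.
move=> i; rewrite addn0 => /(leq_trans _) lt.
have /card_gt0P[v vW] : 0 < #|W| by apply: lt.
exact: (exact_cone vW).
Qed.

(** The zeroth power has bound 0, so [bound'] can be trivial; the pendant case then only asks that
    [B] be positive, which an edge with [T] empty provides. *)
Lemma vanishes_has_matching1 W B :
  gap_bound 1 W B -> vanishes (has_matching G 1) W (B + 1).
Proof.
apply: (@vanishes_has_matchingS 0 (fun _ _ => True) (gap_bound 1)) => //.
- by move=> T B0 _; apply: vanishes_le (vanishes_has_matching0 (W := T)).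
- exact: gap_boundS.
- exact: gap_bound_isolated.
move=> W0 T x y z B0 bW _ xW yW _ _ xy _.
have nin w : w \notin (set0 : {set 'I_n}) by rewrite inE.
have nadj v w : w \in (set0 : {set 'I_n}) -> ~~ G v w by rewrite inE.
have [B' -> _] := gap_bound_isolated bW (sub0set W0) xW yW (nin x) (nin y) xy
  (nadj x) (nadj y).
by exists B'.
Qed.

Lemma vanishes_has_matching2 W B :
  gap_bound 2 W B -> vanishes (has_matching G 2) W (B + 2).
Proof.
apply: (@vanishes_has_matchingS 1 (gap_bound 1) (gap_bound 2)).
- exact: vanishes_has_matching1.
- exact: gap_boundS.
- exact: gap_bound_isolated.
- exact: gap_bound_pendant.
Qed.

(** Since [#|cover M| = m + (#|M| + 2)], this yields regularity at least [#|M| + 2]. Exactness would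
    pass from [cover M] at [m.+1] down to [W'] at [m], against the induction hypothesis. *)
Lemma not_exact_cover D M m : is_matching G M -> #|M| = m.+2 -> #|D| <= 2 ->
  gaps_outside D M -> ~ exact F (has_matching G 2) (cover M) m.
Proof.
elim: m M => [|m IHm] M mM cM cD gM.
  have cW : #|cover M| = 4 by rewrite card_cover_matching // cM.
  (* The empty face is a cycle that bounds nothing: two disjoint edges need all four vertices, so no
     face has size 1. *)
  pose c : {ffun {set 'I_n} -> F} := [ffun A => (A == set0)%:R%R].
  have PW : has_matching G 2 (cover M).
    by rewrite has_matchingE; apply/existsP; exists M; rewrite mM cM eqxx subxx.
  case/(_ c) => [A||b sb].
  - rewrite ffunE; have [-> _|_] := eqVneq A set0; last by rewrite eqxx.
    by rewrite /face sub0set setD0 PW cards0.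
  - apply/ffunP => A; rewrite bdE ffunE big1 // => t tA.
    by rewrite ffunE -cards_eq0 cardsU1 tA GRing.mulr0.
  suff -> : b = 0%R.
    rewrite bd0 => /ffunP/(_ set0)/eqP; rewrite !ffunE eqxx.
    by rewrite eq_sym GRing.oner_eq0.
  apply/ffunP => A; rewrite ffunE; apply/eqP/negPn/negP => /sb.
  case/and3P => sA /(has_matching_card Girr); rewrite cardsD (setIidPr sA) cW.
  by move=> le /eqP eA; rewrite eA in le.
(* There are at least three edges, and at most two lie in [D]. *)
have [e] : exists e, e \in M :\: D.
  apply/set0Pn; rewrite -card_gt0 cardsD subn_gt0 cM.
  by apply: leq_ltn_trans (subset_leq_card (subsetIr _ _)) _; apply: leq_ltn_trans cD _.
case/setDP=> eM eD ex; have /andP[sE tM] := mM.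
have /edgesP[x [y [xy de]]] := subsetP sE _ eM.
set M' := M :\ e; set W' := cover M'.
have sM' : M' \subset M := subsetDl _ _.
have mM' := matching_sub sM' mM.
have cM' : #|M'| = m.+2 by move: cM; rewrite (cardsD1 e) eM => -[].
have gM' : gaps_outside D M'.
  by move=> f g fM gM'; apply: gM; apply: (subsetP sM').
apply: (IHm M' mM' cM' cD gM').
have gap_e f : f \in M' -> gap G e f.
  case/setD1P=> fe fM; have := gM e f eM fM; rewrite eq_sym => /(_ fe).
  by rewrite (negPf eD) orbF.
have out v : v \in e -> v \notin W'.
  move=> ve; apply/bigcupP => -[f /gap_e/gapP[dis _]].
  by rewrite (disjointFr dis ve).
have iso v w : v \in e -> w \in W' -> ~~ G v w.
  by move=> ve /bigcupP[f /gap_e/gapP[_ h] wf]; apply: h.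
have xe : x \in e by rewrite de !inE eqxx.
have ye : y \in e by rewrite de !inE eqxx orbT.
have [xW' yW'] := (out x xe, out y ye).
have dW : cover M = x |: (y |: W').
  have -> : cover M = e :|: W' by rewrite -cover_setU1 setD1K.
  by rewrite de setUA.
have xnW : x \notin y |: W' by rewrite in_setU1 negb_or (edge_neq Girr xy).
have dWx : cover M :\ x = y |: W' by rewrite dW setU1K.
have dWy : (y |: W') :\ y = W' by rewrite setU1K.
have xW : x \in cover M by rewrite dW setU11.
have mono := @has_matching_mono _ G.
(* Once [x] is removed, [y] is isolated, so the link of [x] is a cone. *)
have cone : exact F (has_matching G 2) (y |: W') m.+1.
  apply: (@exact_cone _ _ y) => [|U]; first exact: setU11.
  by rewrite dWy => sU; rewrite has_matching_isolated // => w /(subsetP sU); apply: iso.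
rewrite -dWx in cone.
have := exact_deletion xW (mono 2) cone ex; rewrite dWx => exQ.
have := @exact_link F n y (y |: W') (setU11 _ _) (colon x (has_matching G 2)) m
  (monotone_colon (mono 2)); rewrite dWy => link.
apply: (@eq_exact _ _ (colon x (has_matching G 2))) => [U sU|].
  by rewrite /colon has_matching_isolated // => w /(subsetP sU); apply: iso.
apply: link => //.
apply: (@eq_exact _ _ (has_matching G 1)) => [U sU|].
  rewrite /colon has_matching_leaf //.
  - by apply: contraNN xW'; apply/subsetP.
  - by apply: contraNN yW'; apply/subsetP.
  - by move=> w /(subsetP sU); apply: iso.
(* Matchings inside [W'] have at most [m + 2] edges, so the edge ideal has bound [m + 3] there, and
   [m + (m + 3) < 2 * (m + 2)]. *)
apply: (@vanishes_has_matching1 W' m.+2); last first.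
  by rewrite card_cover_matching // cM' addn1 -addnn !addSn !addnS.
move=> N D' mN sN _ _; rewrite -leq_double -(card_cover_matching mN).
by rewrite -cM' -(card_cover_matching mM') subset_leq_card.
Qed.

End Vanishing.
End Matchings.

(** * Admissible matchings *)

Section Admissible.
Variables (n : nat) (G : rel 'I_n).
Implicit Types (M D : {set {set 'I_n}}).

Lemma forest_onW V : forest G -> forest_on G V.
Proof.
apply: contraNN => /existsP[l /existsP[c /and4P[uc sc _ cc]]].
apply/existsP; exists l; apply/existsP; exists c; rewrite uc sc cc !andbT /=.
by apply/allP => v _; rewrite inE.
Qed.

Lemma partition_singletons (T : finType) (A D : {set T}) : D \subset A ->
  D != set0 -> partition (D |: [set [set e] | e in A :\: D]) A.
Proof.
move=> sDA D0.
have mem1 B : B \in [set [set e] | e in A :\: D] ->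
    exists2 e, B = [set e] & (e \in A) && (e \notin D).
  by case/imsetP => e /setDP[eA eD] ->; exists e; rewrite ?eA.
have s0 : set0 \notin [set [set e] | e in A :\: D].
  by apply/negP => /mem1[e /setP/(_ e)]; rewrite !inE eqxx.
have [||tD _] := @trivIsetU1 _ D [set [set e] | e in A :\: D] _ _ s0.
- by move=> B /mem1[e -> /andP[_ eD]]; rewrite disjoint_sym disjoints1.
- apply/trivIsetP => B C /mem1[b -> _] /mem1[c -> _] bc.
  by rewrite disjoints1 inE; apply: contraNneq bc => ->.
apply/and3P; split=> //; last by rewrite in_setU1 negb_or s0 eq_sym D0.
rewrite /cover bigcup_setU big_set1.
apply/eqP/setP => e; rewrite inE; apply/orP/idP => [[/(subsetP sDA)//|]|eA].
  by case/bigcupP => B /mem1[e' -> /andP[eA _]]; rewrite inE => /eqP ->.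
have [eD|eD] := boolP (e \in D); [by left | right].
by apply/bigcupP; exists [set e]; rewrite ?inE //; apply: imset_f; rewrite inE eA eD.
Qed.

Lemma gaps_outsideI D M : gaps_outside G D M -> gaps_outside G (D :&: M) M.
Proof. by move=> g e f eM fM ef; rewrite !inE eM fM !andbT; apply: g. Qed.

(** The blocks are [E] and the singletons of the other edges. There are at least [#|M| - 1] of them
    because [#|E| <= 2], which is the admissibility inequality. *)
Lemma gaps_outside_adm D M : forest G -> is_matching G M -> M != set0 ->
  #|D| <= 2 -> gaps_outside G D M -> adm_matching G 2 M.
Proof.
move=> Gf mM M0 cD gM; rewrite /adm_matching mM /=.
(* A block must be a nonempty part of [M]: [D] is cut down to [M], or replaced by a single edge if
   it misses [M]. *)
have [E [sEM E0 cE gE]] : exists E : {set {set 'I_n}}, [/\ E \subset M, E != set0, #|E| <= 2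
    & gaps_outside G E M].
  have [D0|D0] := eqVneq (D :&: M) set0; last first.
    exists (D :&: M); split=> //; first exact: subsetIr.
      exact: leq_trans (subset_leq_card (subsetIl _ _)) cD.
    exact: gaps_outsideI.
  have [e eM] := set0Pn _ M0; exists [set e]; split.
  - by rewrite sub1set.
  - by apply/set0Pn; exists e; rewrite inE.
  - by rewrite cards1.
  - move=> f g fM gM' /(gaps_outsideI gM fM gM'); rewrite D0 !inE orbF => ->.
    by [].
have pP := partition_singletons sEM E0.
apply/existsP; exists (E |: [set [set e] | e in M :\: E]); set Q := _ |: _.
have memQ B : B \in Q -> B = E \/ exists2 e, B = [set e] & e \notin E.
  case/setU1P => [->|/imsetP[e /setDP[_ eE] ->]]; [by left | by right; exists e].
have cQ : #|M| <= #|Q| + 1.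
  have EQ : E \notin [set [set e] | e in M :\: E].
    have [e eE] := set0Pn _ E0; apply/negP => /imsetP[f /setDP[_ fE] eq].
    by move: eE fE; rewrite eq !inE eqxx.
  rewrite /Q cardsU1 EQ card_imset; last exact: set1_inj.
  by rewrite cardsD (setIidPr sEM) add1n addn1 -addn2 addnC -leq_subLR leq_sub2l.
apply/and5P; split=> //.
- by case/and3P: pP.
- apply/forall_inP => B1 B1Q; apply/forall_inP => B2 B2Q.
  have [h1 h2] := (memQ _ B1Q, memQ _ B2Q).
  apply/implyP => B12; apply/forall_inP => e eB1; apply/forall_inP => f fB2.
  have /and3P[/eqP covQ tQ _] := pP.
  have eM : e \in M by rewrite -covQ; apply/bigcupP; exists B1.
  have fM : f \in M by rewrite -covQ; apply/bigcupP; exists B2.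
  have ef : e != f.
    apply: contraNneq B12 => ef; move: fB2; rewrite -ef => eB2.
    by rewrite -(def_pblock tQ B1Q eB1) (def_pblock tQ B2Q eB2).
  have /orP[//|/andP[eE fE]] := gE e f eM fM ef.
  case/eqP: B12; case: h1 => [->|[e' e1 e'E]]; last first.
    by move: eB1 eE; rewrite e1 inE => /eqP ->; rewrite (negPf e'E).
  case: h2 => [->//|[f' e2 f'E]].
  by move: fB2 fE; rewrite e2 inE => /eqP ->; rewrite (negPf f'E).
- rewrite /admissable_seq; apply/andP; split.
    apply/allP => x /mapP[B]; rewrite mem_enum => BQ ->; rewrite card_gt0.
    by apply: contraNneq (_ : set0 \notin Q) => [<-//|]; case/and3P: pP.
  by rewrite sumnE big_map big_enum size_map -cardE -(card_partition pP) -addnBA.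
- by apply/forall_inP => B _; apply: forest_onW.
Qed.

(** Admissibility bounds the sum of [#|B| - 1] over the blocks by 1, so at most one block is not a
    singleton. It has two edges and serves as [D]. *)
Lemma adm_gaps_outside M : adm_matching G 2 M ->
  is_matching G M /\ exists2 D : {set {set 'I_n}}, #|D| <= 2 & gaps_outside G D M.
Proof.
case/andP => mM /existsP[Q /and5P[pQ Q0 gQ /andP[_ sQ] _]]; split=> //.
have /and3P[/eqP covQ tQ _] := pQ.
have cQ : \sum_(B in Q) (#|B| - 1) <= 1.
  rewrite sumnB => [|B BQ]; last first.
    by rewrite card_gt0; apply: contraNneq Q0 => <-.
  by move: sQ; rewrite sumnE big_map big_enum size_map -cardE -addnBA //
    sum1_card leq_subLR.
have block e f : e \in M -> f \in M -> e != f ->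
    gap G e f || [exists B in Q, [&& 1 < #|B|, e \in B & f \in B]].
  move=> eM fM ef; have [eQ|neQ] := eqVneq (pblock Q e) (pblock Q f).
    have ee : e \in pblock Q e by rewrite mem_pblock covQ.
    have fe : f \in pblock Q e by rewrite eQ mem_pblock covQ.
    apply/orP; right; apply/existsP; exists (pblock Q e).
    rewrite pblock_mem ?covQ // ee fe !andbT.
    by apply/card_gt1P; exists e, f.
  apply/orP; left; have /forall_inP/(_ (pblock Q e)) := gQ.
  rewrite pblock_mem ?covQ // => /(_ isT)/forall_inP/(_ (pblock Q f)).
  rewrite pblock_mem ?covQ // neQ => /(_ isT)/forall_inP/(_ e).
  rewrite mem_pblock covQ => /(_ eM)/forall_inP/(_ f).
  by rewrite mem_pblock covQ; apply.
have [/existsP[B0 /andP[B0Q big0]]|/existsPn small] :=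
    boolP [exists B in Q, 1 < #|B|]; last first.
  exists set0; rewrite ?cards0 // => e f eM fM ef.
  have /orP[->//|/existsP[B /and3P[BQ big _]]] := block e f eM fM ef.
  by have := small B; rewrite BQ big.
exists B0.
  move: cQ; rewrite (bigD1 B0) //= => /(leq_trans (leq_addr _ _)).
  by rewrite leq_subLR.
move=> e f eM fM ef.
have /orP[->//|/existsP[B /and4P[BQ big eB fB]]] := block e f eM fM ef.
have [<-|BB] := eqVneq B B0; first by rewrite eB fB orbT.
(* A second block with several edges would push the sum to 2. *)
move: cQ; rewrite (bigD1 B0) //= (bigD1 B) ?BQ //= addnA.
move=> /(leq_trans (leq_addr _ _)); rewrite leqNgt.
by rewrite -[2]/(1 + 1) leq_add // subn_gt0.
Qed.

End Admissible.

(** * Assembling the regularity *)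

Lemma matching_powerE n (G : rel 'I_n) k m : symmetric G -> irreflexive G ->
  matching_power G k m = mon_ideal (has_matching G k) m.
Proof.
move=> Gsym Girr; rewrite /mon_ideal has_matchingE //.
apply: eq_existsb => M; congr [&& _, _ & _].
apply/forallP/subsetP => [h v vM|h v]; first by have := h v; rewrite vM inE.
by case: (boolP (v \in cover M)) => // /h; rewrite inE.
Qed.

Lemma eq_betti (F : fieldType) n (I J : ('I_n -> nat) -> bool) i j :
  I =1 J -> betti F I i j = betti F J i j.
Proof.
move=> e; have v i' : kvalid I i' j =1 kvalid J i' j by move=> b; rewrite /kvalid e.
have mx i' : koszul_mx F I i' j = koszul_mx F J i' j.
  by apply/matrixP => a b; rewrite !mxE /kentry !v.
rewrite /betti !mx; congr (_ - _ - _)%N.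
by apply: eq_card => b; rewrite !inE v.
Qed.

Theorem theorem4p10 (F : fieldType) (n : nat) (G : rel 'I_n) :
  symmetric G -> irreflexive G -> forest G -> 2 <= mat G ->
  reg_is F (matching_power G 2) (aim G 2 + 2).
Proof.
move=> Gsym Girr Gforest mat2.
have bettiP i j : betti F (matching_power G 2) i j = 0 <->
    (forall W : {set 'I_n}, #|W| = j -> exact F (has_matching G 2) W i).
  rewrite (eq_betti _ _ _ (fun m => matching_powerE 2 m Gsym Girr)).
  exact: betti_eq0P (@has_matching_mono _ _ _) _ _.
have bound W : gap_bound G 2 W (aim G 2).
  move=> M D mM _ cD gM; have [->|M0] := eqVneq M set0; first by rewrite cards0.
  by apply: leq_bigmax_cond; apply: gaps_outside_adm gM.
(* Two disjoint edges form an admissible matching, as a single exceptional block if need be, so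
   [aim G 2] is at least 2. *)
have [N [mN cN]] : exists N : {set {set 'I_n}}, is_matching G N /\ #|N| = 2.
  have [/existsP[M /andP[mM]]|/existsPn small] :=
      boolP [exists M : {set {set 'I_n}}, is_matching G M && (1 < #|M|)].
    case/card_gt1P => e [f [eM fM ef]]; exists [set e; f]; rewrite cards2 ef.
    by split=> //; apply: matching_sub mM; rewrite subUset !sub1set eM.
  suff : mat G <= 1 by rewrite leqNgt mat2.
  by apply/bigmax_leqP => M mM; have := small M; rewrite mM -leqNgt.
have gN : gaps_outside G N N by move=> e f eN fN _; rewrite eN fN orbT.
have aim2 : 2 <= aim G 2 by rewrite -{1}cN; apply: (bound setT N N); rewrite ?cN.
have [|M admM aimE] := @eq_bigmax_cond _ [pred M | adm_matching G 2 M] (fun M => #|M|).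
  apply/card_gt0P; exists N; rewrite inE; apply: (gaps_outside_adm (D := N)) => //.
    by rewrite -card_gt0 cN.
  by rewrite cN.
rewrite inE in admM; have [mM [D cD gM]] := adm_gaps_outside admM.
have cM : #|M| = aim G 2 by rewrite -aimE.
split=> [|i j].
  (* The extremal Betti number sits at homological index [aim G 2 - 2] and degree [2 * aim G 2]. *)
  have [m am] : exists m, aim G 2 = m.+2 by case: (aim G 2) aim2 => [|[|m]] // _; exists m.
  exists m, #|cover M|; split; last first.
    by rewrite (card_cover_matching Girr mM) cM am -addnn addn2 !addnS.
  move/bettiP/(_ _ erefl); apply: (@not_exact_cover _ _ Gsym Girr F Gforest D M m) => //.
  by rewrite cM am.
move=> nz; rewrite leqNgt; apply/negP => lt; apply: nz; apply/bettiP => W cW.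
by apply: (vanishes_has_matching2 Gsym Girr Gforest (bound W)); rewrite cW.
Qed.
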